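(* Assume $\mathrm{add}(\mathcal M)=\mathfrak c$ (e.g. assume CH). Then there exists an $\mathrm{add}(\mathcal M)$-Luzin set $L\subseteq[\mathbb N]^\infty$ which satisfies $\mathrm{Split}(B_\Lambda,B_\Lambda)$ but does not satisfy $\mathrm{Split}(C_\Omega,C_\Omega)$.
   Context: $[\mathbb N]^\infty$ is the set of infinite subsets of $\mathbb N$, a subspace of $P(\mathbb N)$ identified with the Cantor space $\{0,1\}^{\mathbb N}$. $\mathcal M$ is the ideal of meager sets; $\mathrm{add}(\mathcal M)$ is the least cardinality of a family of meager sets of reals whose union is not meager; $\mathfrak c=2^{\aleph_0}$. For an uncountable cardinal $\kappa$, a $\kappa$-Luzin set is a set $L$ with $|L|\ge\kappa$ such that $|L\cap M|<\kappa$ for every meager set $M$ (of the ambient space). A cover of a space $X$ is a family $\mathcal U$ of subsets of $X$ with $\bigcup\mathcal U=X$ such that $X\not\subseteq U$ for every $U\in\mathcal U$; it is a large cover if every $x\in X$ lies in infinitely many members, and an $\omega$-cover if every finite subset of $X$ is contained in some member. $B_\Lambda$ is the collection of countable large covers of $X$ by Borel sets; $C_\Omega$ is the collection of countable $\omega$-covers of $X$ by clopen sets. $X$ satisfies $\mathrm{Split}(\mathfrak U,\mathfrak V)$ if every $\mathcal U\in\mathfrak U$ can be partitioned into two disjoint subfamilies each containing a subfamily belonging to $\mathfrak V$. *)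

(* Defs.v *)
From HB Require Import structures.
From mathcomp Require Import all_boot all_order all_algebra.
From mathcomp Require Import mathcomp_extra boolp classical_sets functions.
From mathcomp Require Import cardinality reals topology cantor measure.

Set Implicit Arguments.
Unset Strict Implicit.
Unset Printing Implicit Defensive.

Local Open Scope classical_set_scope.

Notation CS := cantor_space.

Definition infinite_subsets : set CS := [set x | infinite_set [set n : nat | x n]].

Definition nowhere_dense (A : set CS) : Prop := interior (closure A) = set0.
Definition meager (A : set CS) : Prop :=
  exists F : nat -> set CS, (forall n, nowhere_dense (F n)) /\ A `<=` \bigcup_n F n.

Definition card_lt T U (A : set T) (B : set U) : Prop :=
  (A #<= B)%card /\ ~ (B #<= A)%card.

(* add(M) = c : since add(M) <= c holds in ZFC, this says that every family of
   fewer than c meager sets has a meager union. *)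
Definition addM_eq_c : Prop :=
  forall F : set (set CS), card_lt F [set: CS] ->
    (forall M, F M -> meager M) -> meager (\bigcup_(M in F) M).

(* kappa-Luzin set, where kappa is the cardinality of the set K *)
Definition kappa_Luzin T (K : set T) (L : set CS) : Prop :=
  (K #<= L)%card /\ forall M, meager M -> card_lt (L `&` M) K.

Definition is_cover (X : set CS) (U : set (set CS)) : Prop :=
  [/\ forall A, U A -> A `<=` X,
      \bigcup_(A in U) A = X &
      forall A, U A -> ~ (X `<=` A)].

Definition large_cover (X : set CS) (U : set (set CS)) : Prop :=
  is_cover X U /\ forall x, X x -> infinite_set [set A | U A /\ A x].

Definition omega_cover (X : set CS) (U : set (set CS)) : Prop :=
  is_cover X U /\
  forall F : set CS, finite_set F -> F `<=` X -> exists2 A, U A & F `<=` A.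

Definition rel_open (X A : set CS) : Prop := exists V, open V /\ A = X `&` V.
Definition rel_clopen (X A : set CS) : Prop :=
  A `<=` X /\ rel_open X A /\ rel_open X (X `\` A).
Definition rel_Borel (X A : set CS) : Prop := <<s X, rel_open X >> A.

Definition B_Lambda (X : set CS) (U : set (set CS)) : Prop :=
  [/\ countable U, large_cover X U & forall A, U A -> rel_Borel X A].

Definition C_Omega (X : set CS) (U : set (set CS)) : Prop :=
  [/\ countable U, omega_cover X U & forall A, U A -> rel_clopen X A].

Definition Split_cov (UU VV : set CS -> set (set CS) -> Prop) (X : set CS) : Prop :=
  forall U, UU X U ->
    exists V1 V2 : set (set CS),
      [/\ V1 `|` V2 = U, V1 `&` V2 = set0,
          (exists2 W, W `<=` V1 & VV X W) &
          (exists2 W, W `<=` V2 & VV X W)].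

(* Main.v *)
Require Import Defs.
From mathcomp Require Import all_boot all_order all_algebra.
From mathcomp Require Import mathcomp_extra boolp classical_sets functions.
From mathcomp Require Import cardinality reals topology cantor measure.
From mathcomp Require finmap.
From mathcomp Require Import wochoice.

(** Enumerating the continuum with small initial segments, choose at stage [a]
    a pair of reals avoiding the [< c] meager sets listed so far: a generic [x],
    and the symmetric difference [y] of [x] with the complement of [A], where
    [A] is [a] or its complement, picked so that [A] is positive for the filter
    built so far.  Then [x `&` y = x `&` A], so the Luzin set [L] so obtained
    generates an ultrafilter, and the clopen omega-cover by the sets
    [{x in L | n in x}] cannot be split.

    On the other hand, Borel sets are open modulo meager.  Given a large Borel
    cover [(u_k)] of [L], countably many generic choices produce arbitrarily
    large finite sets [G_n] such that every [x] outside a meager set lies, for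
    infinitely many [n], in all [u_k] with [k] in [G_n]; the [< c] remaining
    points of [L] are handled by one further choice, as their bad choices form
    a meager set.  Two fresh elements of each [G_n] then give two disjoint large
    subcovers. *)

Set Implicit Arguments.
Unset Strict Implicit.
Unset Printing Implicit Defensive.

Local Open Scope classical_set_scope.
Local Open Scope nat_scope.

(** * Infinite sets of naturals, and the topology of the Cantor space in terms of balls *)

Lemma infinite_natP (A : set nat) :
  infinite_set A <-> forall N, exists2 n, N <= n & A n.
Proof.
split=> [infA N|unbA].
  apply: contrapT => noA; apply: infA.
  apply: (@sub_finite_set _ _ `I_N) => [n An|]; last exact: finite_II.
  by rewrite /= ltnNge; apply/negP => leNn; apply: noA; exists n.
move/finite_seqP => [s As]; have [n] := unbA (\max_(i <- s) i).+1.
rewrite As /= => ltn ns; have := leq_bigmax_seq (F := id) _ ns isT.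
by rewrite leqNgt ltn.
Qed.

Definition ball (x : CS) n : set CS := [set y | forall i, i < n -> y i = x i].

Lemma ball_center x n : ball x n x. Proof. by []. Qed.

Arguments ball_center : clear implicits.

Lemma ballW x m n : m <= n -> ball x n `<=` ball x m.
Proof. by move=> le_mn y xy i lt_im; apply: xy; apply: leq_trans lt_im _. Qed.

Lemma ball_sub x y n : ball x n y -> ball y n `<=` ball x n.
Proof. by move=> xy z yz i lt_in; rewrite yz // xy. Qed.

Lemma open_coord n b : open [set x : CS | x n = b].
Proof.
have -> : [set x : CS | x n = b] = proj n @^-1` [set b] by [].
apply: open_comp; last exact: discrete_open.
by move=> x _; apply: proj_continuous.
Qed.

Lemma open_ball x n : open (ball x n).
Proof.
elim: n => [|n IH].
  by rewrite (_ : ball x 0 = setT); [exact: openT|rewrite predeqE].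
rewrite (_ : ball x n.+1 = ball x n `&` [set y | y n = x n]).
  by apply: openI => //; apply: open_coord.
rewrite predeqE => y; split=> [xy|[xy yn] i].
  by split=> [i lt_in|]; apply: xy => //; apply: leqW.
by rewrite ltnS leq_eqVlt => /predU1P[->|/xy].
Qed.

Lemma open_ballP (O : set CS) :
  open O <-> forall x, O x -> exists n, ball x n `<=` O.
Proof.
split=> [oO x Ox|ballO].
  apply: contrapT => noball.
  have /choice[y yP] : forall n, exists y, ball x n y /\ ~ O y.
    move=> n; apply: contrapT => noy; apply: noball; exists n => y xy.
    by apply: contrapT => nOy; apply: noy; exists y.
  (* The product topology is the supremum of those induced by the coordinates, so convergence is
     tested one coordinate at a time; coordinate [i] of [y n] is that of [x] once [n > i]. *)
  have y_x : (y : nat -> CS) @ \oo --> (x : CS).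
    apply/cvg_sup => i U [/= _ [[V /= oV <- /= Vxi]]] /filterS; apply.
    exists i.+1 => // n /= lt_in; rewrite /proj /=.
    by rewrite (yP n).1.
  have [|N _ /(_ N (leqnn N)) /= Oy] := y_x O; first exact: open_nbhs_nbhs.
  exact: (yP N).2 Oy.
rewrite openE => x /ballO[n ballO']; apply: filterS ballO' _.
by apply: open_nbhs_nbhs; split; [exact: open_ball|exact: ball_center].
Qed.

Lemma nowhere_denseP (A : set CS) : nowhere_dense A <->
  forall x n, exists y m, ball y m `<=` ball x n /\ ball y m `&` A = set0.
Proof.
split=> [ndA x n|ballA].
  apply: contrapT => noball.
  suff : interior (closure A) x by rewrite ndA.
  rewrite /interior; apply: (@filterS _ _ _ (ball x n)).
    move=> y xy B /= By; apply: contrapT => nAB.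
    have [m ballB] : exists m, ball y m `<=` B°.
      by apply/(open_ballP _).1; [exact: open_interior|].
    apply: noball; exists y, (maxn m n); split.
      by move=> z /(ballW (leq_maxr m n)); apply: ball_sub.
    rewrite -subset0 => z [yz Az]; apply: nAB; exists z; split=> //.
    by apply: interior_subset; apply: ballB; apply: ballW yz; apply: leq_maxl.
  by apply: open_nbhs_nbhs; split; [exact: open_ball|exact: ball_center].
rewrite /nowhere_dense -subset0 => x.
have /(open_ballP _).1 /[apply] [[n ballcl]] : open (interior (closure A)).
  exact: open_interior.
have [y [m [sub_yx yA]]] := ballA x n.
have /interior_subset clAy := ballcl _ (sub_yx _ (ball_center y m)).
have [|z [Az yz]] := clAy (ball y m).
  by apply: open_nbhs_nbhs; split; [exact: open_ball|exact: ball_center].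
by suff : set0 z; [|rewrite -yA].
Qed.

(** * Meager sets and the Baire category theorem *)

Lemma meagerS (A B : set CS) : A `<=` B -> meager B -> meager A.
Proof. by move=> AB [F [ndF BF]]; exists F; split=> // x /AB/BF. Qed.

Lemma nowhere_dense_meager (A : set CS) : nowhere_dense A -> meager A.
Proof. by move=> ndA; exists (fun=> A); split=> // x Ax; exists 0. Qed.

Lemma meager0 : meager set0.
Proof.
by apply: nowhere_dense_meager; rewrite /nowhere_dense closure0 interior0.
Qed.

Lemma meager_bigcup (F : nat -> set CS) :
  (forall n, meager (F n)) -> meager (\bigcup_n F n).
Proof.
move=> /choice[G GP].
exists (fun k =>
  if @unpickle (nat * nat)%type k is Some (n, m) then G n m else set0).
split=> [k|x [n _ Fnx]].
  case: unpickle => [[n m]|]; first exact: (GP n).1.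
  by rewrite /nowhere_dense closure0 interior0.
have [m _ Gx] := (GP n).2 _ Fnx.
by exists (pickle (n, m)) => //; rewrite pickleK.
Qed.

Lemma meagerU (A B : set CS) : meager A -> meager B -> meager (A `|` B).
Proof.
move=> mA mB; apply: (@meagerS _ (\bigcup_n (if n is 0 then A else B))).
  by move=> x [Ax|Bx]; [exists 0|exists 1].
by apply: meager_bigcup; case.
Qed.

Lemma nowhere_dense_set1 (x : CS) : nowhere_dense [set x].
Proof.
apply/nowhere_denseP => y n.
pose z : CS := fun i => if i < n then y i else ~~ x i.
exists z, n.+1; split.
  by move=> t zt i lt_in; rewrite zt ?leqW // /z lt_in.
rewrite -subset0 => t [zt tx]; have := zt n (leqnn _).
by rewrite tx /z ltnn; case: (x n).
Qed.

(** Nested balls are chosen, step [n] entering a ball that misses [F n] and prescribing strictly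
    more coordinates, so that in the limit a point is pinned down. *)
Lemma Baire_cantor (M : set CS) : meager M -> exists x, ~ M x.
Proof.
case=> F [ndF MF].
have /choice[next nextP] : forall np : nat * (CS * nat), exists q : CS * nat,
    [/\ ball q.1 q.2 `<=` ball np.2.1 np.2.2, np.2.2 < q.2 &
        ball q.1 q.2 `&` F np.1 = set0].
  move=> [n [x k]]; have [y [m [yx yF]]] := (nowhere_denseP _).1 (ndF n) x k.
  exists (y, maxn m k.+1); split=> /=; last 2 first.
  - exact: leq_maxr.
  - by rewrite -subset0 -yF; apply: setSI; apply: ballW; exact: leq_maxl.
  by apply: subset_trans yx; apply: ballW; exact: leq_maxl.
pose p := fix p n := if n is m.+1 then next (m, p m) else (point, 0).
have le_p n : n <= (p n).2.
  by elim: n => // n IH; have [_ /= lt_p _] := nextP (n, p n); apply: leq_ltn_trans lt_p.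
have sub_p m n : m <= n -> ball (p n).1 (p n).2 `<=` ball (p m).1 (p m).2.
  elim: n => [|n IH]; first by rewrite leqn0 => /eqP->.
  rewrite leq_eqVlt => /predU1P[-> //|/IH{}IH].
  by have [/= sub _ _] := nextP (n, p n); apply: subset_trans IH.
(* By [le_p], ball number [i.+1] prescribes at least [i.+1] coordinates, so coordinate [i] is
   already final there. *)
pose x : CS := fun i => (p i.+1).1 i.
have px n : ball (p n).1 (p n).2 x.
  move=> i lt_i; rewrite /x.
  case: (leqP n i.+1) => [le_n|lt_n].
    exact: (sub_p _ _ le_n _ (ball_center _ _)).
  by rewrite (sub_p _ _ (ltnW lt_n) _ (ball_center _ _)).
exists x => /MF[n _ Fx]; have [_ _ pF] := nextP (n, p n).
suff : set0 x by []; rewrite -pF; split=> //; exact: (px n.+1).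
Qed.

(** Translation by [c] in the group $(\mathbb Z/2)^{\mathbb N}$. It carries balls to balls of the
    same length, hence preserves meagerness. *)
Definition xor_cantor (c x : CS) : CS := fun n => c n (+) x n.

Lemma xor_cantorK c : involutive (xor_cantor c).
Proof. by move=> x; apply: funext => n; rewrite /xor_cantor addKb. Qed.

Lemma xor_ball c x y n : ball (xor_cantor c x) n (xor_cantor c y) <-> ball x n y.
Proof.
split=> xy i lt_in; last by rewrite /xor_cantor xy.
by have /addbI := xy i lt_in.
Qed.

Lemma meager_xor c (M : set CS) : meager M -> meager (xor_cantor c @^-1` M).
Proof.
case=> F [ndF MF]; exists (fun n => xor_cantor c @^-1` F n); split; last first.
  by move=> x /MF[n _ Fx]; exists n.
move=> n; apply/nowhere_denseP => x k.
have [y [m [yx yF]]] := (nowhere_denseP _).1 (ndF n) (xor_cantor c x) k.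
exists (xor_cantor c y), m; split=> [z|].
  by rewrite -(xor_ball c) xor_cantorK => /yx; rewrite xor_ball.
rewrite -subset0 => z []; rewrite -(xor_ball c) xor_cantorK => yz Fz.
by suff : set0 (xor_cantor c z); [|rewrite -yF].
Qed.

(** * Coding meager sets by points of the Cantor space *)

Definition cyl (s : seq bool) : set CS := ball (nth false s) (size s).

Lemma cylE x n : cyl (mkseq x n) = ball x n.
Proof.
rewrite predeqE /cyl size_mkseq => y.
by split=> xy i lt_in; rewrite xy // nth_mkseq.
Qed.

(* A point of the Cantor space, read as a subset of [nat * seq bool], codes
   a sequence of open sets; the non-dense ones are discarded. *)
Definition coded_open (a : CS) (n : nat) : set CS :=
  \bigcup_(s in [set s | a (pickle (n, s))]) cyl s.

Definition coded_meager (a : CS) : set CS :=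
  \bigcup_(n in [set n | dense (coded_open a n)]) ~` coded_open a n.

Lemma meager_coded_meager a : meager (coded_meager a).
Proof.
apply: (@meagerS _ (\bigcup_n
    (if `[< dense (coded_open a n) >] then ~` coded_open a n else set0))).
  by move=> x [n /= /asboolP dn nx]; exists n => //; rewrite dn.
apply: meager_bigcup => n; apply: nowhere_dense_meager.
case: asboolP => [dn|_]; last by rewrite /nowhere_dense closure0 interior0.
apply/nowhere_denseP => x k.
have [|y [xy [s as_ sy]]] := dn (ball x k) _ (open_ball x k).
  by exists x.
exists y, (maxn k (size s)); split.
  by move=> z /(ballW (leq_maxl _ _)); apply: ball_sub.
rewrite -subset0 => z [/(ballW (leq_maxr _ _)) yz]; apply; exists s => //.
exact: ball_sub yz.
Qed.

(** Codes are points of [CS], so a recursion indexed by [CS] meets every meager set up to inclusion.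
    The code lists, for each [n], the cylinders disjoint from [F n]; their union is dense because
    [F n] is nowhere dense. *)
Lemma coded_meager_cofinal (M : set CS) :
  meager M -> exists a, M `<=` coded_meager a.
Proof.
case=> F [ndF MF].
pose a : CS := fun k => if @unpickle (nat * seq bool)%type k is Some (n, s)
  then `[< cyl s `&` F n = set0 >] else false.
have aE n s : a (pickle (n, s)) = `[< cyl s `&` F n = set0 >].
  by rewrite /a pickleK.
exists a => x /MF[n _ Fx]; exists n.
  move=> O [y Oy] /open_ballP/(_ _ Oy)[k yO].
  have [z [m [zy zF]]] := (nowhere_denseP _).1 (ndF n) y k.
  exists z; split; first exact/yO/zy.
  by exists (mkseq z m); rewrite /= ?aE cylE //; apply/asboolP.
move=> [s /=]; rewrite aE => /asboolP sF sx.
by suff : set0 x; [|rewrite -sF].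
Qed.

(** * Sets of size below the continuum, and well-orders with small segments *)

(** For a subset of [CS] this is cardinality below the continuum, the opposite comparison being
    given by inclusion. *)
Definition small T (I : set T) : Prop := ~ ([set: CS] #<= I)%card.

Lemma smallS T U (I : set T) (J : set U) : (I #<= J)%card -> small J -> small I.
Proof. by move=> IJ sJ /card_le_trans/(_ IJ)/sJ. Qed.

Lemma small_card_lt (I : set CS) : small I -> card_lt I [set: CS].
Proof. by move=> sI; split=> //; apply: card_leT. Qed.

Lemma addM_bigcup (I : set CS) (B : CS -> set CS) : addM_eq_c -> small I ->
  (forall i, I i -> meager (B i)) -> meager (\bigcup_(i in I) B i).
Proof.
move=> addM sI mB; rewrite -(bigcup_image I B id).
apply: addM => [|_ [i Ii <-]]; last exact: mB.
have BI := card_image_le B I.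
by split; [exact: card_le_trans BI (card_leT _)|exact: smallS BI sI].
Qed.

(** Induction on the length peels off one index at a time, so the cardinality of the set of finite
    sequences in [I] never has to be computed. *)
Lemma addM_bigcup_seq (I : set CS) (B : seq CS -> set CS) : addM_eq_c -> small I ->
  (forall s, [set` s] `<=` I -> meager (B s)) ->
  meager (\bigcup_(s in [set s | [set` s] `<=` I]) B s).
Proof.
move=> addM sI mB.
apply: (@meagerS _
    (\bigcup_n \bigcup_(s in [set s | size s = n /\ [set` s] `<=` I]) B s)).
  by move=> x [s sub_s Bx]; exists (size s) => //; exists s.
apply: meager_bigcup => n; elim: n B mB => [|n IH] B mB.
  apply: (@meagerS _ (B [::])); last exact: mB.
  by move=> x [s [/size0nil->]].
apply: (@meagerS _ (\bigcup_(i in I)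
    \bigcup_(s in [set s | size s = n /\ [set` s] `<=` I]) B (i :: s))).
  move=> x [[|i s] [//= [size_s] sub_s Bx]]; exists i; first exact/sub_s/mem_head.
  by exists s => //; split=> // j js; apply: sub_s; rewrite /= inE js orbT.
apply: addM_bigcup => // i Ii; apply: IH => s sub_s; apply: mB => j /=.
by rewrite inE => /predU1P[->|/sub_s].
Qed.

Lemma small_meager (I : set CS) : addM_eq_c -> small I -> meager I.
Proof.
move=> addM sI; rewrite -(image_id I) -bigcup_imset1.
by apply: addM_bigcup => // i _; apply/nowhere_dense_meager/nowhere_dense_set1.
Qed.

(** Category replaces cardinal arithmetic: an injection of [CS] into the union would cover [CS] by
    two small, hence meager, preimages. *)
Lemma smallU (I J : set CS) : addM_eq_c -> small I -> small J -> small (I `|` J).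
Proof.
move=> addM sI sJ /pcard_leP/unsquash g.
have inj_g : injective g by move=> x y; apply: 'inj_g; rewrite inE.
have sg K : small K -> meager (g @^-1` K).
  move=> sK; apply: small_meager => //; apply: smallS sK.
  by apply: card_ge_preimage => x y _ _; apply: inj_g.
have [x] := Baire_cantor (meagerU (sg _ sI) (sg _ sJ)).
by apply; rewrite -preimage_setU; exact: 'funS_g.
Qed.

(* If some segment is not small, pull the order back along an injection into
   the least such segment. *)
Lemma small_well_order : exists lt : CS -> CS -> Prop,
  [/\ well_founded lt, forall a b c, lt a b -> lt b c -> lt a c,
      forall a b, [\/ lt a b, a = b | lt b a] &
      forall a, small [set b | lt b a]].
Proof.
have [R woR] := well_ordering_principle CS.
have minR (P : CS -> Prop) x : P x -> exists2 z, P z & forall y, P y -> R z y.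
  move=> Px; have [|z [[Pz minz] _]] := woR [pred x | `[< P x >]].
    by exists x; apply/asboolP.
  by exists z => [|y Py]; [exact/asboolP|apply: minz; exact/asboolP].
have woT : wo_chain R predT by move=> A _; apply: woR.
have anti x y : R x y -> R y x -> x = y.
  by move=> xy yx; apply: (wo_chain_antisymmetric woT) => //; rewrite xy yx.
have tot x y : R x y \/ R y x.
  by apply/orP; apply: (wo_chainW woT).
have trans x y z : R x y -> R y z -> R x z.
  (* Transitivity is read off from the least element [t] of the triple, using antisymmetry. *)
  move=> xy yz; have [t] := minR (fun t => [\/ t = x, t = y | t = z]) x (Or31 _ _ erefl).
  move=> Et mint; have tx : R t x by apply: mint; constructor.
  have ty : R t y by apply: mint; constructor.
  have tz : R t z by apply: mint; constructor.
  case: Et => Et; subst t => //; first by rewrite (anti _ _ xy tx).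
  by rewrite -(anti _ _ yz ty).
pose seg a : set CS := [set b | R b a /\ b <> a].
have [g inj_g sg] : exists2 g : CS -> CS, injective g & forall a, small (seg (g a)).
  have [all_small|/existsNP[a0 /contrapT a0P]] := pselect (forall a, small (seg a)).
    by exists id => // ? ?.
  have [a /pcard_leP/unsquash g mina] := minR (fun a => [set: CS] #<= seg a)%card a0 a0P.
  exists g => [x y|x]; first by apply: 'inj_g; rewrite inE.
  move=> /mina aR; have [gx] : seg a (g x) by exact: 'funS_g.
  by apply; apply: anti.
exists (fun a b => R (g a) (g b) /\ g a <> g b); split.
- move=> a; apply: contrapT => nacc.
  (* The [R]-least image of an inaccessible point would have only accessible predecessors. *)
  pose P c := exists2 b, c = g b & ~ Acc (fun a b => R (g a) (g b) /\ g a <> g b) b.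
  have [|_ [b -> nb] minb] := minR P (g a); first by exists a.
  apply: nb; constructor => c [cb cneb]; apply: contrapT => nc.
  by apply: cneb; apply: anti => //; apply: minb; exists c.
- move=> a b c [ab nab] [bc nbc]; split; first exact: trans bc.
  by move=> ac; apply: nab; apply: anti => //; rewrite ac.
- move=> a b; have [->|nab] := pselect (a = b); first exact: Or32.
  by have [ab|ba] := tot (g a) (g b); [apply: Or31|apply: Or33]; split=> // /inj_g // /esym.
- move=> a; apply: smallS (sg a).
  by apply: (@card_ge_preimage _ _ (seg (g a)) g) => x y _ _; apply: inj_g.
Qed.

(** * Construction of the Luzin set by transfinite recursion *)

(** Recursion with a choice at every stage. Since [Q a f p] sees [f] only below [a], the values
    found so far may be extended by the default [point], which keeps [Q] a condition on total
    functions. *)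
Lemma well_founded_choice (I : Type) (T : pointedType) (lt : I -> I -> Prop)
    (Q : I -> (I -> T) -> T -> Prop) :
  well_founded lt ->
  (forall a f g p, (forall b, lt b a -> f b = g b) -> Q a f p -> Q a g p) ->
  (forall a f, (forall b, lt b a -> Q b f (f b)) -> exists p, Q a f p) ->
  exists f, forall a, Q a f (f a).
Proof.
move=> wf Qext Qex.
pose ext a (h : forall b, lt b a -> T) b :=
  if pselect (lt b a) is left ba then h b ba else point.
pose f := Fix wf (fun=> T) (fun a h => get [set p | Q a (ext a h) p]).
have fE a : f a = get [set p | Q a (ext a (fun b _ => f b)) p].
  rewrite /f Fix_eq // => b h h' hh'.
  by rewrite (_ : ext b h = ext b h') //; apply: funext => c; rewrite /ext; case: pselect.
exists f; elim/(well_founded_ind wf) => a IH; have [p Qp] := Qex a f IH.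
have fext b : lt b a -> f b = ext a (fun b _ => f b) b.
  by rewrite /ext; case: pselect.
apply: (Qext _ (ext a (fun b _ => f b))) => [b /fext->//|].
rewrite fE; apply: (@getPex _ [set q | Q a (ext a (fun b _ => f b)) q]).
by exists p; apply: Qext Qp.
Qed.

(** Lets a generic [x] meet a prescribed infinite set infinitely often: a finite condition extended
    by [true] reaches an element of [B] beyond any bound [N]. *)
Lemma meager_finite_meet (B : set nat) :
  infinite_set B -> meager [set x : CS | finite_set [set n | B n /\ x n]].
Proof.
move=> /infinite_natP infB.
apply: (@meagerS _ (\bigcup_N [set x : CS | forall n, N <= n -> B n -> ~~ x n])).
  move=> x /= finBx; apply: contrapT => nx.
  suff : infinite_set [set n | B n /\ x n] by apply.
  apply/infinite_natP => N; apply: contrapT => noN; apply: nx; exists N => //=.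
  by move=> n leNn Bn; apply/negP => xn; apply: noN; exists n.
apply: meager_bigcup => N; apply: nowhere_dense_meager.
apply/nowhere_denseP => x k.
have [n + Bn] := infB (maxn N k); rewrite geq_max => /andP[leNn lekn].
pose y : CS := fun i => if i < k then x i else true.
exists y, n.+1; split.
  by move=> z zy i ltik; rewrite zy /y ?ltik // ltnS (leq_trans (ltnW ltik)).
rewrite -subset0 => z [zy /(_ n leNn Bn)].
by rewrite zy // /y ltnNge lekn.
Qed.

Section LuzinConstruction.
Variables (lt : CS -> CS -> Prop).
Hypothesis (addM : addM_eq_c) (wf_lt : well_founded lt).
Hypothesis lt_trans : forall a b c, lt a b -> lt b c -> lt a c.
Hypothesis lt_total : forall a b, [\/ lt a b, a = b | lt b a].
Hypothesis small_seg : forall a, small [set b | lt b a].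

Let meet (p : CS * CS) n := p.1 n && p.2 n.

(** The clauses yield, in order: the Luzin property; distinct first coordinates, hence continuum
    many points; the decision of the set [a] by a pair of members; infinite finite intersections,
    stated for earlier stages only. *)
Definition luzin_step (a : CS) (f : CS -> CS * CS) (p : CS * CS) :=
  [/\ forall b, lt b a \/ b = a -> ~ coded_meager b p.1 /\ ~ coded_meager b p.2,
      forall b, lt b a -> p.1 <> (f b).1,
      exists c, forall n, meet p n -> a n = c &
      forall s, (forall b, b \in s -> lt b a) ->
        infinite_set [set n | meet p n && all (fun b => meet (f b) n) s]].

Lemma luzin_step_ext a f g p : (forall b, lt b a -> f b = g b) ->
  luzin_step a f p -> luzin_step a g p.
Proof.
move=> fg [Q1 Q2 Q3 Q4]; split=> // [b ba|s sa]; first by rewrite -fg //; apply: Q2.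
rewrite (_ : mkset _ =
  [set n | meet p n && all (fun b => meet (f b) n) s]); first exact: Q4.
apply: eq_set => n; congr (is_true (_ && _)).
by apply: eq_in_all => b /sa ba; rewrite fg.
Qed.

Lemma seq_max (s : seq CS) b0 : b0 \in s ->
  exists2 b, b \in s & forall c, c \in s -> c != b -> lt c b.
Proof.
elim: s b0 => // d s IH b0 _; case: s IH => [_|e s /(_ e (mem_head _ _))[b bs maxb]].
  by exists d; rewrite ?mem_head // => c; rewrite inE => ->.
have [db|->|bd] := lt_total d b.
- exists b; first by rewrite inE bs orbT.
  by move=> c; rewrite inE => /predU1P[->//|/maxb].
- exists b; first by rewrite mem_head.
  by move=> c; rewrite inE => /predU1P[->|/maxb//]; rewrite eqxx.
- exists d; first by rewrite mem_head.
  move=> c; rewrite inE => /predU1P[->|/maxb cb]; first by rewrite eqxx.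
  by move=> _; have [->//|/cb cb'] := eqVneq c b; apply: lt_trans bd.
Qed.

(** The last clause of [luzin_step], applied at the latest stage in [s], covers all of [s]. *)
Lemma luzin_step_inter (P : CS -> Prop) f (s : seq CS) :
  (forall b, P b -> luzin_step b f (f b)) -> (forall b, b \in s -> P b) ->
  infinite_set [set n | all (fun b => meet (f b) n) s].
Proof.
move=> Qf sP; case: (pselect (exists b, b \in s)) => [[b0 b0s]|nos].
  have [b bs maxb] := seq_max b0s.
  have [_ _ _ /(_ [seq c <- s | c != b])] := Qf b (sP b bs).
  move=> Q4; apply: sub_infinite_set (Q4 _) => [n /= /andP[fbn alls]|c].
    apply/allP => c cs; have [->//|cb] := eqVneq c b.
    by apply: (allP alls); rewrite mem_filter cb.
  by rewrite mem_filter => /andP[cb cs]; apply: maxb.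
case: s sP nos => [|b s] _ nos; last by case: nos; exists b; rewrite mem_head.
rewrite (_ : mkset _ = setT); first exact: infinite_nat.
by rewrite predeqE.
Qed.

(* The pair consists of a generic [x] and of its symmetric difference with the
   complement of [A], so that it meets exactly in [x `&` A]. *)
Lemma luzin_step_ex a f :
  (forall b, lt b a -> luzin_step b f (f b)) -> exists p, luzin_step a f p.
Proof.
move=> Qf; pose inter s : set nat := [set n | all (fun b => meet (f b) n) s].
have inf_inter s : [set` s] `<=` (lt^~ a) -> infinite_set (inter s).
  by apply: luzin_step_inter => b; apply: Qf.
(* If both values of [c] failed, with witnesses [s0] and [s1], then [inter (s0 ++ s1)] would be
   covered by two finite sets. *)
have [c infA] : exists c, forall s, [set` s] `<=` (lt^~ a) ->
    infinite_set ([set n | a n = c] `&` inter s).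
  apply: contrapT => /forallNP noc.
  have [/existsNP[s0 /not_implyP[sa0 /contrapT fin0]]
        /existsNP[s1 /not_implyP[sa1 /contrapT fin1]]] := (noc true, noc false).
  apply: (inf_inter (s0 ++ s1)) => [b /=|].
    by rewrite mem_cat => /orP[/sa0|/sa1].
  have : finite_set (([set n | a n = true] `&` inter s0) `|`
                     ([set n | a n = false] `&` inter s1)) by rewrite finite_setU.
  apply: sub_finite_set => n; rewrite /inter /= all_cat => /andP[n0 n1].
  by case: (a n); [left|right].
pose A n := a n == c; pose d : CS := fun n => ~~ A n.
pose M := \bigcup_(b in (lt^~ a)) (coded_meager b `|` [set (f b).1]) `|` coded_meager a.
have mM : meager M.
  apply: meagerU; last exact: meager_coded_meager.
  apply: addM_bigcup => // [|b _]; first exact: small_seg.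
  apply: meagerU; first exact: meager_coded_meager.
  exact/nowhere_dense_meager/nowhere_dense_set1.
pose N := \bigcup_(s in [set s | [set` s] `<=` (lt^~ a)])
  [set x : CS | finite_set [set n | ([set n | a n = c] `&` inter s) n /\ x n]].
have mN : meager N.
  apply: addM_bigcup_seq => // [|s sa]; first exact: small_seg.
  exact/meager_finite_meet/infA.
(* One generic [x] serves both points: [y] avoids [M] because [x] avoids the translate of [M] by
   [d]. *)
have [x xP] := Baire_cantor (meagerU (meagerU mM (meager_xor d mM)) mN).
pose y := xor_cantor d x.
have [Mx My Nx] : [/\ ~ M x, ~ M y & ~ N x].
  by split=> nx; apply: xP; [left; left|left; right|right].
have xy n : x n && y n = A n && x n.
  by rewrite /y /xor_cantor /d; case: (A n); case: (x n).
exists (x, y); split=> [b ba|b ba xfb||s sa].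
- split=> [bx|ny]; [apply: Mx|apply: My].
    by case: ba => ba; [left; exists b => //; left|right; rewrite -ba].
  by case: ba => ba; [left; exists b => //; left|right; rewrite -ba].
- by apply: Mx; left; exists b => //; right.
- by exists c => n; rewrite /meet xy => /andP[/eqP].
- move=> fin; apply: Nx; exists s; first exact: sa.
  apply: sub_finite_set fin => n [[/= an sn] xn].
  by rewrite /= /meet xy /A an eqxx xn.
Qed.

(** A member of [L] lying in [coded_meager c] must have been chosen before stage [c], and the stages
    before [c] form a small set. The last property makes the filter generated by [L] an
    ultrafilter. *)
Lemma luzin_ultrafilter_subbase_of_order : exists L : set CS,
  [/\ kappa_Luzin [set: CS] L,
      forall s : seq CS, [set` s] `<=` L -> infinite_set [set n | all (@^~ n) s] &
      forall a : CS, exists x y c,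
        [/\ L x, L y & forall n, x n && y n -> a n = c]].
Proof.
have [f fP] : exists f, forall a, luzin_step a f (f a).
  apply: well_founded_choice wf_lt _ luzin_step_ex => a f g p.
  exact: luzin_step_ext.
pose L : set CS := [set x | exists a, x = (f a).1 \/ x = (f a).2].
have f1_inj : injective (fun a => (f a).1).
  move=> a b ab; have [lab|//|lba] := lt_total a b.
    by have [_ /(_ a lab)] := fP b; rewrite ab.
  by have [_ /(_ b lba)] := fP a; rewrite ab.
exists L; split.
- split=> [|M /coded_meager_cofinal[c Mc]].
    apply: (@card_le_trans _ _ _ ((fun a => (f a).1) @` setT)).
      have /card_eqPle[] // := @inj_card_eq _ _ setT _ (in2W f1_inj).
    by apply: subset_card_le => _ [a _ <-]; exists a; left.
  apply: small_card_lt.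
  apply: (smallS _ (@smallU ((fun a => (f a).1) @` [set a | lt a c])
                            ((fun a => (f a).2) @` [set a | lt a c]) addM _ _)).
  + apply: subset_card_le => x [[a xa] /Mc cx].
    have lac : lt a c.
      have [//|ac|lca] := lt_total a c; exfalso.
        have [/(_ c (or_intror (esym ac)))[n1 n2] _ _ _] := fP a.
        by case: xa => xE; rewrite xE in cx.
      have [/(_ c (or_introl lca))[n1 n2] _ _ _] := fP a.
      by case: xa => xE; rewrite xE in cx.
    by case: xa => ->; [left|right]; exists a.
  + exact: smallS (card_image_le _ _) (@small_seg c).
  + exact: smallS (card_image_le _ _) (@small_seg c).
- move=> s sL; have /choice[idx idxP] :
    forall x, exists a, L x -> x = (f a).1 \/ x = (f a).2.
    move=> x; have [[a xa]|nLx] := pselect (L x); first by exists a.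
    by exists point.
  apply: sub_infinite_set 
    (luzin_step_inter (P := fun=> True) (s := map idx s) (fun a _ => fP a) _)
    => [n /allP alls|//].
  apply/allP => x xs.
  by move: (idx x) (idxP x (sL x xs)) (alls _ (map_f idx xs)) => a [->|->] /andP[].
- move=> a; have [_ _ [c cP] _] := fP a.
  by exists (f a).1, (f a).2, c; split=> //; exists a; [left|right].
Qed.

End LuzinConstruction.

Lemma luzin_ultrafilter_subbase : addM_eq_c -> exists L : set CS,
  [/\ kappa_Luzin [set: CS] L,
      forall s : seq CS, [set` s] `<=` L -> infinite_set [set n | all (@^~ n) s] &
      forall a : CS, exists x y c,
        [/\ L x, L y & forall n, x n && y n -> a n = c]].
Proof.
move=> addM; have [lt [wf trans tot sm]] := small_well_order.
exact: luzin_ultrafilter_subbase_of_order trans tot sm.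
Qed.

(** * The clopen omega-cover that cannot be split *)

(** A partition of the cover colours [n] by whether [U n] is in [V1]. Two members [x], [y] of [L]
    make the colour constant on their intersection, but each half has a set [U n] containing both,
    so both halves would share a colour. *)
Lemma ultrafilter_subbase_not_Split (L : set CS) :
  (forall s : seq CS, [set` s] `<=` L -> infinite_set [set n | all (@^~ n) s]) ->
  (forall a : CS, exists x y c, [/\ L x, L y & forall n, x n && y n -> a n = c]) ->
  ~ Split_cov C_Omega C_Omega L.
Proof.
move=> infL decL; pose U n := [set x : CS | L x /\ x n].
have pairL x y : L x -> L y -> [set` [:: x; y]] `<=` L.
  by move=> Lx Ly z; rewrite /= !inE => /orP[]/eqP->.
have coordN n : L `\` U n = L `&` [set x | x n = false].
  rewrite predeqE => x; split=> [[Lx nx]|[Lx /= xn]]; split=> //.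
    by apply/negbTE/negP => xn; apply: nx.
  by case=> _; rewrite xn.
have CU : C_Omega L (range U).
  split; first exact: card_image_le.
    split; first split=> [_ [n _ <-] x []//||_ [n _ <-] LU].
    - rewrite predeqE => x; split=> [[_ [n _ <-] []]//|Lx].
      have [|n /= /andP[xn _]] := infinite_setN0 (infL [:: x] _).
        by move=> z; rewrite /= inE => /eqP->.
      by exists (U n) => //; exists n.
    (* The complement of [n] is decided by some [x] and [y]; if [U n] contained [L], both would
       contain [n] and their intersection would be the singleton of [n]. *)
    - have [x [y [c [Lx Ly xyc]]]] := decL (fun m => m != n).
      have := infL [:: x; y] (pairL _ _ Lx Ly); apply.
      apply: sub_finite_set (finite_set1 n) => m /= /and3P[xm ym _].
      have [_ xn] := LU x Lx; have [_ yn] := LU y Ly.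
      have := xyc n; rewrite xn yn eqxx => /(_ isT) c0.
      by have := xyc m; rewrite xm ym -c0 => /(_ isT)/negbFE/eqP.
    move=> _ /finite_seqP[s ->] sL.
    have [n /= /allP sn] := infinite_setN0 (infL s sL).
    by exists (U n) => [|x xs]; [exists n|split; [exact: sL|exact: sn]].
  move=> _ [n _ <-]; split; first by move=> x [].
  split; first by exists [set x | x n = true]; split=> //; apply: open_coord.
  exists [set x | x n = false]; split; first exact: open_coord.
  exact: coordN.
move=> /(_ _ CU)[V1 [V2 [V12 V0 [W1 WV1 [_ [_ om1] _]] [W2 WV2 [_ [_ om2] _]]]]].
have [x [y [c [Lx Ly xyc]]]] := decL (fun n => `[< V1 (U n) >]).
have find W :
    (forall F : set CS, finite_set F -> F `<=` L -> exists2 A, W A & F `<=` A) ->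
    W `<=` range U -> exists2 n, W (U n) & `[< V1 (U n) >] = c.
  move=> om WU; have [A WA xyA] := om _ (finite_seq [:: x; y]) (pairL _ _ Lx Ly).
  have [n _ An] := WU A WA; exists n; first by rewrite An.
  apply: xyc; rewrite -An in xyA.
  have [|_ ->] := xyA x; first by rewrite /= !inE eqxx.
  by have [|_ ->] := xyA y; first by rewrite /= !inE eqxx orbT.
have [|n Wn cn] := find _ om1; first by move=> A /WV1; rewrite -V12; left.
have [|m Wm cm] := find _ om2; first by move=> A /WV2; rewrite -V12; right.
have /asboolP V1m : `[< V1 (U m) >] by rewrite cm -cn; apply/asboolP/WV1.
suff : (V1 `&` V2) (U m) by rewrite V0.
by split=> //; apply: WV2.
Qed.

(** * Borel sets modulo meager sets *)

Lemma nowhere_dense_boundary (O : set CS) :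
  open O -> nowhere_dense (closure O `\` O).
Proof.
move=> oO; apply/nowhere_denseP => x n.
have [[y [xy Oy]]|xO] := pselect (ball x n `&` O !=set0).
  have [m yO] := (open_ballP O).1 oO y Oy.
  exists y, (maxn m n); split.
    by move=> z /(ballW (leq_maxr m n)); apply: ball_sub.
  by rewrite -subset0 => z [/(ballW (leq_maxl m n))/yO Oz []].
exists x, n; split=> //; rewrite -subset0 => z [xz [clz _]]; apply: xO.
have [|t [Ot xt]] := clz (ball x n); last by exists t.
by apply: open_nbhs_nbhs; split=> //; apply: open_ball.
Qed.

(** The Baire property, relative to [X]: the sets having it form a sigma-algebra. A complement is
    matched with the exterior of [O], at the cost of the nowhere dense boundary. *)
Lemma rel_Borel_open_mod_meager (X A : set CS) : rel_Borel X A ->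
  exists O M, [/\ open O, meager M & forall x, X x -> ~ M x -> (A x <-> O x)].
Proof.
move=> BA; suff : [set A | exists O M,
    [/\ open O, meager M & forall x, X x -> ~ M x -> (A x <-> O x)]] A by [].
apply: (smallest_sub _ _ BA) => {A BA}; last first.
  move=> _ [V [oV ->]] /=; exists V, set0; split=> //; first exact: meager0.
  by move=> x Xx _; split=> [[]|].
split=> [|A [O [M [oO mM AO]]]|A /choice[O /choice[M AOM]]].
- exists set0, set0; split=> //; [exact: open0|exact: meager0].
- exists (~` closure O), (M `|` (closure O `\` O)); split.
  + by apply: closed_openC; apply: closed_closure.
  + by apply: meagerU => //; apply/nowhere_dense_meager/nowhere_dense_boundary.
  + move=> x Xx nM; have {}AO : A x <-> O x by apply: AO => // Mx; apply: nM; left.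
    split=> [[_ nAx] clx|nclx].
      by apply: nM; right; split=> // /AO.
    by split=> // /AO/subset_closure.
- exists (\bigcup_n O n), (\bigcup_n M n); split.
  + by apply: bigcup_open => n _; have [] := AOM n.
  + by apply: meager_bigcup => n; have [] := AOM n.
  + move=> x Xx nM; have {}AO n : A n x <-> O n x.
      by have [_ _] := AOM n; apply=> // Mx; apply: nM; exists n.
    by split=> -[n _ /AO]; exists n.
Qed.

(** * Selectors of finite sets of indices *)

Lemma infinite_uniq_seq (A : set nat) m : infinite_set A ->
  exists s : seq nat, [/\ uniq s, m <= size s & [set` s] `<=` A].
Proof.
move=> /(infinite_set_fset m)[B BA mB].
by exists (finmap.enum_fset B); split=> //; exact: finmap.fset_uniq.
Qed.

Lemma open_bigcap_seq (O : nat -> set CS) (s : seq nat) :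
  (forall k, open (O k)) -> open [set x | [set` s] `<=` O^~ x].
Proof.
move=> oO; elim: s => [|k s IH].
  by rewrite (_ : mkset _ = setT); [exact: openT|rewrite predeqE].
rewrite (_ : mkset _ = O k `&` [set x | [set` s] `<=` O^~ x]); first exact: openI.
rewrite predeqE => x; split=> [sx|[kx sx] i /=].
  by split=> [|i /= si]; apply: sx; rewrite /= inE ?eqxx // si orbT.
by rewrite inE => /predU1P[->|/sx].
Qed.

Definition selector (sz : nat -> nat) (G : nat -> seq nat) :=
  forall n, uniq (G n) /\ sz n <= size (G n).

Definition often_within (G : nat -> seq nat) (P : set nat) :=
  forall N, exists2 n, N <= n & [set` G n] `<=` P.

(** Stage [n] decodes a word [s] and, if possible, takes a list whose open sets have a common point
    in [cyl s]. Near a point of [Y] such lists exist, and the common open set gives a smaller ball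
    on which stage [n] succeeds. *)
Lemma generic_selector (O : nat -> set CS) (Y : set CS) (sz : nat -> nat) :
  (forall k, open (O k)) -> (forall y, Y y -> infinite_set (O^~ y)) ->
  exists2 G, selector sz G & meager (Y `&` [set y | ~ often_within G (O^~ y)]).
Proof.
move=> oO infO; pose inter (s : seq nat) : set CS := [set x | [set` s] `<=` O^~ x].
have /choice[G GP] : forall n, exists t : seq nat, [/\ uniq t, sz n <= size t &
    forall s (j : nat), unpickle n = Some (s, j) ->
    (exists t', [/\ uniq t', sz n <= size t' & cyl s `&` inter t' !=set0]) ->
    cyl s `&` inter t !=set0].
  move=> n; case: (unpickle n) => [[s j]|]; last first.
    by exists (iota 0 (sz n)); split=> //; [exact: iota_uniq|rewrite size_iota].
  have [[t [ut st ct]]|not] := pselect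
      (exists t', [/\ uniq t', sz n <= size t' & cyl s `&` inter t' !=set0]).
    by exists t; split=> // _ _ [<- _].
  (* Where no list works, any duplicate-free list of the right length will do. *)
  exists (iota 0 (sz n)); split=> //; [exact: iota_uniq|by rewrite size_iota|].
  by move=> _ _ [<- _] /not.
exists G => [n|]; first by have [] := GP n.
apply: (@meagerS _ (\bigcup_N [set y | Y y /\ forall n, N <= n -> ~ inter (G n) y])).
  move=> y [Yy /existsNP[N nN]]; exists N => //; split=> // n leNn yn.
  by apply: nN; exists n.
apply: meager_bigcup => N; apply: nowhere_dense_meager.
apply/nowhere_denseP => x k.
set P := mkset _.
have [[z [xz [Yz _]]]|noP] := pselect (ball x k `&` P !=set0); last first.
  by exists x, k; split=> //; rewrite -subset0 => z zP; apply: noP; exists z.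
(* The dummy counter [j] makes every word recur at stages beyond any [N]. *)
have [j ltN] := injective_gtn (f := fun j : nat => pickle (mkseq x k, j))
  (fun i j (e : pickle _ = pickle _) => congr1 snd (pcan_inj pickleK e)) N.
have [_ _ /(_ _ _ (pickleK _))] := GP (pickle (mkseq x k, j)).
rewrite cylE => -[|w [xw wG]].
  have [t [ut st tO]] := infinite_uniq_seq (sz (pickle (mkseq x k, j))) (infO z Yz).
  by exists t; split=> //; exists z.
have [m wO] := (open_ballP _).1 (open_bigcap_seq _ oO) w wG.
exists w, (maxn m k); split.
  by move=> t /(ballW (leq_maxr m k)); apply: ball_sub.
rewrite -subset0 => t [/(ballW (leq_maxl m k))/wO tG [_ /(_ _ (ltnW ltN))]].
exact.
Qed.

(* A generic point of the Cantor space codes a selector through the lengths of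
   its runs of [false]. *)
Lemma small_selector (I : set CS) (P : CS -> set nat) (sz : nat -> nat) :
  addM_eq_c -> small I -> (forall i, I i -> infinite_set (P i)) ->
  exists2 G, selector sz G & forall i, I i -> often_within G (P i).
Proof.
move=> addM sI infP.
pose codes (z : CS) n (s : seq nat) :=
  z (n + pickle s) /\ forall i, i < pickle s -> z (n + i) = false.
have codes_inj z n s t : codes z n s -> codes z n t -> s = t.
  move=> [zs lts] [zt ltt]; apply: (pcan_inj pickleK).
  by case: (ltngtP (pickle s) (pickle t)) => // [/ltt|/lts]; rewrite ?zs ?zt.
pose good i n s := [/\ uniq s, sz n <= size s & [set` s] `<=` P i].
pose bad i := \bigcup_N
  [set z : CS | forall n, N <= n -> ~ exists2 s, codes z n s & good i n s].
have [z zbad] : exists z, ~ (\bigcup_(i in I) bad i) z.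
  apply: Baire_cantor; apply: addM_bigcup => // i Ii.
  apply: meager_bigcup => N; apply: nowhere_dense_meager.
  apply/nowhere_denseP => x k.
  pose n := maxn N k; have [s [us ss sP]] := infinite_uniq_seq (sz n) (infP i Ii).
  (* From [k] on, [y] is true only at [n + pickle s], and [k <= n]; hence the run of [false]
     starting at [n] codes [s]. *)
  pose y : CS := fun j => if j < k then x j else j == n + pickle s.
  have lekn j : k <= n + j by rewrite (leq_trans (leq_maxr N k)) ?leq_addr.
  exists y, (n + pickle s).+1; split.
    by move=> w yw j ltjk; rewrite yw /y ?ltjk // ltnS (leq_trans (ltnW ltjk)).
  rewrite -subset0 => w [yw /(_ n (leq_maxl _ _))]; apply; exists s => //.
  split=> [|j ltj]; first by rewrite yw // /y ltnNge lekn eqxx.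
  by rewrite yw ?ltnS ?leq_add2l 1?ltnW // /y ltnNge lekn eqn_add2l ltn_eqF.
have /choice[G GP] : forall n, exists s, [/\ uniq s, sz n <= size s &
    forall t, codes z n t -> uniq t -> sz n <= size t -> t = s].
  move=> n; have [[s [zs us ss]]|nos] := pselect
      (exists s, [/\ codes z n s, uniq s & sz n <= size s]).
    by exists s; split=> // t zt _ _; apply: codes_inj zt zs.
  exists (iota 0 (sz n)); split; [exact: iota_uniq|by rewrite size_iota|].
  by move=> t zt ut st; case: nos; exists t.
exists G => [n|i Ii N]; first by have [] := GP n.
apply: contrapT => noN; apply: zbad; exists i => //; exists N => //=.
move=> n leNn [s zs [us ss sP]]; apply: noN; exists n => //.
by have [_ _ /(_ s zs us ss) <-] := GP n.
Qed.

(** Greedy choice: before step [n] only [n.*2] indices have been used, so [G n] still offers two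
    fresh ones, [a n] and [b n]. All these are distinct, and each [G n] inside [P] puts one of
    either kind into [P]. *)
Lemma selector_split (G : nat -> seq nat) :
  selector (fun n => n.*2.+2) G ->
  exists A : set nat, forall P, often_within G P ->
    infinite_set (P `&` A) /\ infinite_set (P `&` ~` A).
Proof.
move=> selG.
pose rest n (h : seq nat) := [seq x <- G n | x \notin h].
pose hist := fix hist n := if n is m.+1
  then [:: nth 0 (rest m (hist m)) 0, nth 0 (rest m (hist m)) 1 & hist m] else [::].
pose a n := nth 0 (rest n (hist n)) 0; pose b n := nth 0 (rest n (hist n)) 1.
have size_hist n : size (hist n) = n.*2 by elim: n => //= n ->; rewrite doubleS.
have size_rest n : 1 < size (rest n (hist n)).
  have [uG sG] := selG n.
  have : size [seq x <- G n | x \in hist n] <= n.*2.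
    rewrite -size_hist; apply: uniq_leq_size; first exact: filter_uniq.
    by move=> x; rewrite mem_filter => /andP[].
  move: sG; rewrite /rest -(count_predC [in hist n] (G n)) !size_filter => sG le_n.
  by rewrite -(leq_add2l n.*2) addn2 (leq_trans sG) // leq_add2r.
have aP n : a n \in G n /\ a n \notin hist n.
  have : a n \in rest n (hist n) by apply: mem_nth; apply: ltnW.
  by rewrite mem_filter => /andP[].
have bP n : b n \in G n /\ b n \notin hist n.
  have : b n \in rest n (hist n) by apply: mem_nth.
  by rewrite mem_filter => /andP[].
have histP m n : m < n -> a m \in hist n /\ b m \in hist n.
  elim: n => // n IH; rewrite ltnS leq_eqVlt => /predU1P[->|/IH[am bm]].
    by rewrite /= !inE !eqxx orbT.
  by rewrite /= !inE am bm !orbT.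
have a_inj : injective a.
  move=> m n e; case: (ltngtP m n) => // /histP[]; first by rewrite e (negPf (aP n).2).
  by rewrite -e (negPf (aP m).2).
have b_inj : injective b.
  move=> m n e; case: (ltngtP m n) => // /histP[_]; first by rewrite e (negPf (bP n).2).
  by rewrite -e (negPf (bP m).2).
have bNa n m : b n <> a m.
  move=> e; have [/histP[]|/histP[]|nm] := ltngtP m n.
  - by rewrite -e (negPf (bP n).2).
  - by rewrite e (negPf (aP m).2).
  - move/eqP: e; rewrite /a /b nm nth_uniq //; first exact: ltnW.
    by apply: filter_uniq; have [] := selG n.
exists (range a) => P GP; pose S : set nat := [set n | [set` G n] `<=` P].
have infS : infinite_set S by apply/infinite_natP.
have inf_image c : injective c -> infinite_set (c @` S).
  move=> c_inj fin; apply: infS; apply: card_le_finite fin.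
  by have /card_eqPle[] := @inj_card_eq _ _ S _ (in2W c_inj).
split.
  apply: sub_infinite_set (inf_image _ _ a_inj) => _ [n Sn <-].
  by split; [apply: Sn; exact: (aP n).1|exists n].
apply: sub_infinite_set (inf_image _ _ b_inj) => _ [n Sn <-].
by split; [apply: Sn; exact: (bP n).1|move=> [m _ /esym/bNa]].
Qed.

(** * Splitting large Borel covers of a Luzin set *)

Lemma B_Lambda_sub (X : set CS) (U V : set (set CS)) : B_Lambda X U -> V `<=` U ->
  (forall x, X x -> infinite_set [set A | V A /\ A x]) -> B_Lambda X V.
Proof.
move=> [cU [[UX _ XU] _] BU] VU infV; split.
- exact: sub_countable (subset_card_le VU) cU.
- split=> //; split=> [A /VU/UX//||A /VU/XU//].
  rewrite predeqE => x; split=> [[A /VU/UX]|/infV/infinite_setN0[A [VA Ax]]]; first exact.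
  by exists A.
- by move=> A /VU/BU.
Qed.

(** The points in [N], or where the generic selector [E] fails, lie in a meager set, which meets [L]
    in a small set; a second selector [F] serves exactly these points. *)
Lemma Luzin_often_within (L : set CS) (B : nat -> set CS) (sz : nat -> nat) :
  addM_eq_c -> kappa_Luzin [set: CS] L -> (forall k, rel_Borel L (B k)) ->
  (forall x, L x -> infinite_set (B^~ x)) ->
  exists2 G, selector sz G & forall x, L x -> often_within G (B^~ x).
Proof.
move=> addM [_ LuzinL] BB infB.
have /choice[O /choice[M OM]] := fun k => rel_Borel_open_mod_meager (BB k).
pose N := \bigcup_k M k.
have mN : meager N by apply: meager_bigcup => k; have [] := OM k.
have OB x : (L `\` N) x -> O^~ x = B^~ x.
  move=> [Lx nNx]; rewrite predeqE => k; have [_ _ /(_ x Lx) BO] := OM k.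
  by apply: iff_sym; apply: BO => Mx; apply: nNx; exists k.
(* [E n] and [F n] go to positions [n.*2] and [n.*2.+1] of the interleaved selector, whence the
   sizes demanded. *)
have [||E selE mE] := @generic_selector O (L `\` N) (fun n => sz n.*2).
- by move=> k; have [] := OM k.
- by move=> x LNx; rewrite OB //; apply: infB; case: LNx.
have [_ sR] := LuzinL _ (meagerU mN mE).
have [F selF FB] :=
  small_selector (fun n => sz n.*2.+1) addM sR (fun x LNx => infB x LNx.1).
exists (fun n => if odd n then F n./2 else E n./2) => [n|x Lx K].
  have [uF sF] := selF n./2; have [uE sE] := selE n./2.
  rewrite -[n in sz n]odd_double_half; by case: (odd n).
have [Rx|nRx] := pselect
  ((L `&` (N `|` ((L `\` N) `&` [set y | ~ often_within E (O^~ y)]))) x).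
  have [n leKn Fn] := FB x Rx K; exists n.*2.+1.
    by rewrite leqW // (leq_trans leKn) // -addnn leq_addr.
  by rewrite /= odd_double uphalf_double.
have nNx : ~ N x by move=> Nx; apply: nRx; split=> //; left.
have [n leKn En] : exists2 n, K <= n & [set` E n] `<=` O^~ x.
  by apply: contrapT => nE; apply: nRx; split=> //; right; split=> // /(_ K).
exists n.*2; first by rewrite (leq_trans leKn) // -addnn leq_addr.
by rewrite odd_double doubleK -OB.
Qed.

Lemma Luzin_Split_B_Lambda (L : set CS) :
  addM_eq_c -> kappa_Luzin [set: CS] L -> Split_cov B_Lambda B_Lambda L.
Proof.
move=> addM LuzinL U BU; have [cU [[UL _ _] lU] borU] := BU.
have [x0 Lx0] : L !=set0.
  apply/set0P/negP => /eqP L0; case: LuzinL => + _.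
  by rewrite L0 => /card_le0P; rewrite predeqE => /(_ point)[/(_ I)].
have infU : infinite_set U by apply: sub_infinite_set (lU x0 Lx0) => A [].
(* A bijective enumeration turns infinite or disjoint sets of indices into infinite or disjoint
   subfamilies. *)
have /card_esym/card_set_bijP[u [uU u_inj u_surj]] := eq_card_nat cU infU.
have uE x : [set A | U A /\ A x] = u @` [set k | u k x].
  rewrite predeqE => A; split=> [[UA Ax]|[k kx <-]]; last by split=> //; apply: uU.
  by have [k _ kA] := u_surj A UA; exists k => //=; rewrite kA.
have [|x Lx|G selG GL] := Luzin_often_within (fun n => n.*2.+2) (B := u) addM LuzinL.
- by move=> k; apply: borU; apply: uU.
- by move=> fin; apply: (lU x Lx); rewrite uE; apply: finite_image.
have [A AP] := selector_split selG.
have half (D : set nat) : (forall x, L x -> infinite_set ((u^~ x : set nat) `&` D)) ->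
    exists2 W, W `<=` u @` D & B_Lambda L W.
  move=> infD; exists (u @` D) => //; apply: B_Lambda_sub BU _ _.
    by move=> _ [k _ <-]; apply: uU.
  move=> x Lx fin; apply: (infD x Lx).
  apply: sub_finite_set (finite_preimage (f := u) _ fin) => [k [kx Dk]|k l _ _].
    by split=> //; exists k.
  by apply: u_inj; rewrite inE.
exists (u @` A), (u @` (~` A)); split.
- rewrite -image_setU setUv predeqE => B; split=> [[k _ <-]|/u_surj//].
  exact: uU.
- rewrite -subset0 => _ [[k Ak <-] [l nAl]].
  by move/(u_inj _ _ (mem_setT _) (mem_setT _)) => lk; apply: nAl; rewrite lk.
- by apply: half => x /GL/AP[].
- by apply: half => x /GL/AP[].
Qed.

Theorem theorem5p7 :
  addM_eq_c ->
  exists L : set cantor_space,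
    [/\ L `<=` infinite_subsets,
        kappa_Luzin [set: cantor_space] L,
        Split_cov B_Lambda B_Lambda L &
        ~ Split_cov C_Omega C_Omega L].
Proof.
move=> addM; have [L [LuzinL infL decL]] := luzin_ultrafilter_subbase addM.
exists L; split=> //.
- move=> x Lx; apply: sub_infinite_set (infL [:: x] _) => [n /= /andP[]//|y /=].
  by rewrite inE => /eqP->.
- exact: Luzin_Split_B_Lambda.
- exact: ultrafilter_subbase_not_Split.
Qed.
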